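(* Let $n,m\in\mathbb{N}$. Then $$\int_{-\infty}^{\infty} He_n(x)\,He_m(x)\,\frac{1}{\sqrt{2\pi}}e^{-\frac12 x^2}\,dx=\begin{cases} n! & \text{if } n=m,\\ 0 & \text{if } n\neq m.\end{cases}$$
   Context: For $n\in\mathbb{N}$ the (probabilist's) Hermite polynomial $He_n$ is defined by the Gaussian integral formula $$He_n(x)=\mathbb{E}_{Z\sim\mathcal{N}(0,1)}\big[(x+\imath Z)^n\big]=\int_{-\infty}^\infty (x+\imath z)^n\frac{1}{\sqrt{2\pi}}e^{-\frac12 z^2}\,dz,\qquad \imath=\sqrt{-1}.$$ *)

(* Defs.v *)
From mathcomp Require Import all_boot all_order all_algebra.
From mathcomp Require Import all_classical all_reals all_analysis.
From mathcomp Require Import complex.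

Set Implicit Arguments.
Unset Strict Implicit.
Unset Printing Implicit Defensive.

Import Order.TTheory GRing.Theory Num.Theory.
Import numFieldNormedType.Exports.

Local Open Scope ring_scope.
Local Open Scope complex_scope.

(* Integrals over the real line, with respect to the Lebesgue measure, of
   complex-valued functions: integrability and value are both taken on the
   real and imaginary parts. [Rintegral] is total, hence the separate
   integrability predicate. *)
Definition cintegrable (R : realType) (f : R -> R[i]) : Prop :=
  lebesgue_measure.-integrable setT (EFin \o (fun x => complex.Re (f x))) /\
  lebesgue_measure.-integrable setT (EFin \o (fun x => complex.Im (f x))).

Definition cintegral (R : realType) (f : R -> R[i]) : R[i] :=
  (\int[lebesgue_measure]_(x in setT) complex.Re (f x))
  +i* (\int[lebesgue_measure]_(x in setT) complex.Im (f x)).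

Definition gauss (R : realType) (x : R) : R := normal_pdf 0 1 x.

Lemma gaussE (R : realType) (x : R) :
  gauss x = (Num.sqrt (2 * pi))^-1 * expR (- (1 / 2) * x ^+ 2).
Proof.
rewrite /gauss normal_pdfE ?oner_neq0// /normal_peak /normal_fun.
rewrite expr1n subr0 mul1r mulr_natl.
by congr (_ * expR _); rewrite mul1r mulNr mulNr [2^-1 * _]mulrC.
Qed.

(* The integrand is complex-valued, so He_n(x) lives in R[i]; that it is
   real is a consequence of the definition, not part of it. *)
Definition He (R : realType) (n : nat) (x : R) : R[i] :=
  cintegral (fun z : R => (x +i* z) ^+ n * (gauss z)%:C).

(* Main.v *)
Require Import Defs.
From mathcomp Require Import all_boot all_order all_algebra.
From mathcomp Require Import all_classical all_reals all_analysis.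
From mathcomp Require Import measurable_realfun complex ring lra.

(** Write E for the mean against the standard Gaussian density.  Everything
    rests on Gaussian integration by parts, E[X p(X)] = E[p'(X)] for a
    polynomial p with complex coefficients ([cgauss_meanX]): it holds because
    the density g satisfies g' = - x g, so that (p' - x p) g is the derivative
    of p g, which vanishes at both infinities.

    Let H_0 = 1 and H_{n+1} = x H_n - H_n' be the Hermite polynomials in
    their Rodrigues form.  Integration by parts gives at once
    E[H_{n+1} q] = E[H_n q'] for every polynomial q
    ([cgauss_mean_hermiteSM]), and with H_{m+1}' = (m+1) H_m an induction on n
    yields E[H_n H_m] = n! if n = m, and 0 otherwise.

    It remains to identify He_n(x) = E[(x + iZ)^n] with H_n(x).  Splitting off
    one factor x + iZ and integrating the iZ part by parts, where i^2 = -1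
    produces the sign, gives He_{n+2} = x He_{n+1} - (n+1) He_n ([HeSS]), the
    recurrence that H_n also satisfies ([hermiteSS]). *)

Set Implicit Arguments.
Unset Strict Implicit.
Unset Printing Implicit Defensive.

Import Order.TTheory GRing.Theory Num.Theory.
Import numFieldNormedType.Exports.

Local Open Scope classical_set_scope.
Local Open Scope ring_scope.
Local Open Scope complex_scope.

(** * Real polynomials against the Gaussian density *)

Section RealGaussian.
Variable R : realType.
Implicit Types (p q : {poly R}) (x eps : R).
Local Notation mu := (@lebesgue_measure R).

(** The quantification over every eps makes an induction on the polynomial
    possible: half of eps absorbs the inductive bound, and the other half the
    new factor x, by |x| <= 1 + x^2 and 1 + y <= exp y. *)
Lemma poly_le_expR_sqr p eps : 0 < eps ->
  exists C, forall x, `|p.[x]| <= C * expR (eps * x ^+ 2).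
Proof.
elim/poly_ind: p eps => [|p c IHp] eps eps0.
  by exists 0 => x; rewrite horner0 normr0 mul0r.
have d0 : 0 < eps / 2 by rewrite divr_gt0.
have [C pC] := IHp _ d0.
have C0 : 0 <= C.
  by have := le_trans (normr_ge0 _) (pC 0); rewrite pmulr_lge0// expR_gt0.
(* With d = eps / 2, one has (1 + 1/d) (1 + d x^2) >= 1 + x^2 >= |x|. *)
exists (C * (1 + (eps / 2)^-1) + `|c|) => x.
rewrite hornerD hornerMX hornerC mulrDl.
apply: (le_trans (ler_normD _ _)); apply: lerD.
  have -> : eps * x ^+ 2 = eps / 2 * x ^+ 2 + eps / 2 * x ^+ 2 by field.
  rewrite expRD normrM mulrACA; apply: ler_pM => //.
  have dV : 0 <= (eps / 2)^-1 by rewrite invr_ge0 ltW.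
  apply: (@le_trans _ _ ((1 + (eps / 2)^-1) * (1 + eps / 2 * x ^+ 2))).
    have -> : (1 + (eps / 2)^-1) * (1 + eps / 2 * x ^+ 2) =
      1 + (eps / 2)^-1 + eps / 2 * x ^+ 2 + x ^+ 2 by field; rewrite gt_eqF.
    have dx : 0 <= eps / 2 * x ^+ 2 by rewrite mulr_ge0 ?sqr_ge0 ?(ltW d0).
    have x1 : `|x| <= 1 + x ^+ 2.
      have := sqr_ge0 (`|x| - 1); rewrite sqrrB1 real_normK ?num_real//.
      by have := normr_ge0 x; lra.
    by lra.
  by apply: ler_wpM2l; rewrite ?expR_ge1Dx// addr_ge0.
by rewrite ler_peMr// -[leLHS](@expR0 R) ler_expR mulr_ge0 ?sqr_ge0 ?(ltW eps0)//.
Qed.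

(** A polynomial is absorbed by exp (x^2 / 4), which turns exp (- x^2 / 2) into
    exp (- x^2 / 4), the Gaussian density of variance 2 up to a constant. *)
Lemma poly_gauss_dominated p :
  exists C, forall x, `|p.[x] * gauss x| <= C * normal_pdf 0 (Num.sqrt 2) x.
Proof.
have [|C pC] := @poly_le_expR_sqr p (1 / 4); first by lra.
have s0 : Num.sqrt 2 != 0 :> R by rewrite gt_eqF// sqrtr_gt0.
exists (C * (Num.sqrt (2 * pi))^-1 / normal_peak (Num.sqrt 2)) => x.
rewrite normal_pdfE// mulrA divfK ?gt_eqF ?normal_peak_gt0//.
rewrite normrM [X in _ * X]ger0_norm ?normal_pdf_ge0// gaussE.
rewrite mulrCA [C * _]mulrC -mulrA ler_wpM2l ?invr_ge0 ?sqrtr_ge0//.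
apply: (le_trans (ler_wpM2r _ (pC x))); first exact: expR_ge0.
rewrite -mulrA -expRD /normal_fun sqr_sqrtr ?ler0n// subr0.
suff -> : 1 / 4 * x ^+ 2 + - (1 / 2) * x ^+ 2 = - x ^+ 2 / (2 *+ 2) by [].
by field.
Qed.

Lemma continuous_poly_gauss p : continuous (fun x => p.[x] * gauss x).
Proof.
move=> x; apply: cvgM; first exact: continuous_horner.
by apply: continuous_normal_pdf; rewrite oner_neq0.
Qed.

Lemma measurable_poly_gauss p :
  measurable_fun [set: R] (fun x => p.[x] * gauss x).
Proof.
by apply: measurable_funM; [exact: measurable_poly|exact: measurable_normal_pdf].
Qed.

Lemma integrable_poly_gauss p :
  mu.-integrable setT (EFin \o (fun x => p.[x] * gauss x)).
Proof.
have [C pC] := poly_gauss_dominated p.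
apply: (@le_integrable _ _ _ mu setT _ _
  (fun x => C%:E * (normal_pdf 0 (Num.sqrt 2) x)%:E)%E) => //.
- by apply/measurable_EFinP; exact: measurable_poly_gauss.
- by move=> x _ /=; rewrite lee_fin; apply: (le_trans (pC x)); exact: ler_norm.
- by apply: integrableZl => //; exact: integrable_normal_pdf.
Qed.

Lemma poly_gauss_bounded p : exists C, forall x, `|p.[x] * gauss x| <= C.
Proof.
have [C pC] := poly_gauss_dominated p.
have s0 : Num.sqrt 2 != 0 :> R by rewrite gt_eqF// sqrtr_gt0.
exists (`|C| * normal_peak (Num.sqrt 2)) => x.
apply: (le_trans (pC x)).
apply: (@le_trans _ _ (`|C| * normal_pdf 0 (Num.sqrt 2) x)).
  by rewrite ler_wpM2r ?normal_pdf_ge0// ler_norm.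
by rewrite ler_wpM2l// normal_pdf_ub.
Qed.

Lemma is_derive_gauss x : is_derive x 1 (@gauss R) (- x * gauss x).
Proof.
have -> : @gauss R = (Num.sqrt (2 * pi))^-1 \*:
    (expR \o horner (- (1 / 2) *: 'X^2 : {poly R})).
  by apply/funext => y; rewrite gaussE /= hornerZ hornerXn.
apply: is_derive_eq; rewrite derivZ derivXn /= !hornerE /GRing.scale /=.
by set c := (_^-1 in X in X = _); set e := expR _; rewrite -/c; field.
Qed.

Lemma is_derive_poly_gauss p x :
  is_derive x 1 (fun y => p.[y] * gauss y) ((p^`() - 'X * p).[x] * gauss x).
Proof.
have dg := is_derive_gauss x.
apply: is_derive_eq; rewrite /GRing.scale /= hornerD hornerN hornerM hornerX.
by ring.
Qed.

Lemma integral_itv_poly_gauss p (a b : R) : a < b ->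
  (\int[mu]_(x in `[a, b]) ((p^`() - 'X * p).[x] * gauss x)%:E =
    (p.[b] * gauss b)%:E - (p.[a] * gauss a)%:E)%E.
Proof.
move=> ab; apply: (@continuous_FTC2 _ _ (fun y => p.[y] * gauss y)) => //.
- by apply: continuous_subspaceT; exact: continuous_poly_gauss.
- split.
  + by move=> x _; have [] := is_derive_poly_gauss p x.
  + by apply: cvg_at_right_filter; exact: continuous_poly_gauss.
  + by apply: cvg_at_left_filter; exact: continuous_poly_gauss.
- by move=> x _; rewrite derive1E; have /@derive_val := is_derive_poly_gauss p x.
Qed.

(** The decay at infinity costs one degree: p g is bounded by C / |x| because
    x p g is bounded by C. *)
Lemma poly_gauss_cvg0 p (u : nat -> R) : (forall n, `|u n| = n.+1%:R) ->
  p.[u n] * gauss (u n) @[n --> \oo] --> 0.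
Proof.
move=> un; have [C pC] := poly_gauss_bounded (p * 'X).
apply/norm_cvg0P.
apply: (@squeeze_cvgr _ _ _ _ (cst 0) (fun n => C * harmonic n)).
- near=> n; rewrite normr_ge0 /= ler_pdivlMr ?ltr0n//.
  rewrite -un -normrM mulrAC -hornerMX; exact: pC.
- exact: cvg_cst.
- by rewrite -(mulr0 C); apply: cvgMl_tmp; exact: cvg_harmonic.
Unshelve. all: by end_near. Qed.

(** The integrand is the derivative of p g.  Its integral over [- n - 1, n + 1]
    is a boundary term that tends to 0, and it tends to the integral over the
    whole line by dominated convergence. *)
Lemma integral_deriv_poly_gauss p :
  (\int[mu]_x ((p^`() - 'X * p).[x] * gauss x)%:E = 0)%E.
Proof.
pose I n := `[- n.+1%:R, n.+1%:R : R]%classic.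
pose f x := (p^`() - 'X * p).[x] * gauss x.
have lim0 : (\int[mu]_(x in I n) (f x)%:E @[n --> \oo] --> 0)%E.
  rewrite (_ : (fun _ => _) = EFin \o (fun n => p.[n.+1%:R] * gauss n.+1%:R -
     p.[- n.+1%:R] * gauss (- n.+1%:R))); last first.
    apply/funext => n /=; rewrite integral_itv_poly_gauss//.
    by rewrite (@lt_trans _ _ 0)// ?oppr_lt0.
  apply: cvg_EFin; first exact: nearW.
  rewrite -[0]subr0; apply: cvgB; apply: poly_gauss_cvg0 => n.
    by rewrite normr_nat.
  by rewrite normrN normr_nat.
suff limI : (\int[mu]_(x in I n) (f x)%:E @[n --> \oo] -->
    \int[mu]_x (f x)%:E)%E.
  by move: limI => /(cvg_lim (@ereal_hausdorff R)) <-; exact/cvg_lim.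
under eq_fun do rewrite integral_mkcond.
have mf : measurable_fun setT (EFin \o f).
  by apply/measurable_EFinP; exact: measurable_poly_gauss.
apply: (@dominated_cvg _ _ _ mu setT _ _ _ (fun x => `|f x|%:E)) => //.
- move=> n; apply/(measurable_restrictT _ _).1.
    exact: measurable_itv.
  exact: measurable_funTS.
- move=> x _; apply: cvg_near_cst; near=> n.
  rewrite patchE mem_set// /I /= in_itv /= -ler_norml.
  apply: ltW; apply: (lt_le_trans (archi_boundP (normr_ge0 x))).
  by rewrite ler_nat leqW//; near: n; exact: nbhs_infty_ge.
- exact: (integrable_norm (integrable_poly_gauss _)).
- move=> n x _; rewrite patchE; case: ifP => _ //=.
  by rewrite normr0 lee_fin.
Unshelve. all: by end_near. Qed.

Definition gauss_mean p := \int[mu]_x (p.[x] * gauss x).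

Lemma gauss_mean1 : gauss_mean 1 = 1.
Proof.
rewrite /gauss_mean /Rintegral; under eq_integral do rewrite hornerC mul1r.
by rewrite integral_normal_pdf.
Qed.

Lemma gauss_meanD p q : gauss_mean (p + q) = gauss_mean p + gauss_mean q.
Proof.
rewrite -RintegralD//; try exact: integrable_poly_gauss.
by apply: eq_Rintegral => x _; rewrite hornerD mulrDl.
Qed.

Lemma gauss_meanZ c p : gauss_mean (c *: p) = c * gauss_mean p.
Proof.
rewrite -RintegralZl//; last exact: integrable_poly_gauss.
by apply: eq_Rintegral => x _; rewrite hornerZ mulrA.
Qed.

Lemma gauss_mean0 : gauss_mean 0 = 0.
Proof. by rewrite -[X in gauss_mean X](scale0r 0) gauss_meanZ mul0r. Qed.

Lemma gauss_meanB p q : gauss_mean (p - q) = gauss_mean p - gauss_mean q.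
Proof. by rewrite -scaleN1r gauss_meanD gauss_meanZ mulN1r. Qed.

(** Gaussian integration by parts (Stein's identity). *)
Lemma gauss_meanX p : gauss_mean ('X * p) = gauss_mean p^`().
Proof.
apply/esym/eqP; rewrite -subr_eq0 -gauss_meanB; apply/eqP.
by rewrite /gauss_mean /Rintegral integral_deriv_poly_gauss.
Qed.

End RealGaussian.

(** * Gaussian means of complex polynomials *)

Section ComplexGaussian.
Variable R : realType.
Implicit Types (p q : {poly R[i]}) (z c : R[i]) (x : R).

Lemma ReD z c : complex.Re (z + c) = complex.Re z + complex.Re c.
Proof. by case: z c => [? ?] []. Qed.

Lemma ImD z c : complex.Im (z + c) = complex.Im z + complex.Im c.
Proof. by case: z c => [? ?] []. Qed.

Lemma ReM z c : complex.Re (z * c) =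
  complex.Re z * complex.Re c - complex.Im z * complex.Im c.
Proof. by case: z c => [? ?] []. Qed.

Lemma ImM z c : complex.Im (z * c) =
  complex.Re z * complex.Im c + complex.Im z * complex.Re c.
Proof. by case: z c => [? ?] []. Qed.

Lemma ReMn z n : complex.Re (z *+ n) = complex.Re z *+ n.
Proof. by elim: n => // n IHn; rewrite !mulrS ReD IHn. Qed.

Lemma ImMn z n : complex.Im (z *+ n) = complex.Im z *+ n.
Proof. by elim: n => // n IHn; rewrite !mulrS ImD IHn. Qed.

Lemma ReMr z x : complex.Re (z * x%:C) = complex.Re z * x.
Proof. by rewrite ReM /= mulr0 subr0. Qed.

Lemma ImMr z x : complex.Im (z * x%:C) = complex.Im z * x.
Proof. by rewrite ImM /= mulr0 add0r. Qed.

Local Notation polyRe := (map_poly (@complex.Re R)).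
Local Notation polyIm := (map_poly (@complex.Im R)).

(** At a real point, taking real or imaginary parts of the value amounts to
    taking them coefficientwise; this transfers the real results above to
    complex coefficients. *)
Lemma Re_horner_real p x : complex.Re p.[x%:C] = (polyRe p).[x].
Proof.
rewrite /map_poly horner_poly horner_coef.
rewrite (big_morph _ ReD (erefl : complex.Re 0 = 0)).
by apply: eq_bigr => k _; rewrite -rmorphXn ReMr.
Qed.

Lemma Im_horner_real p x : complex.Im p.[x%:C] = (polyIm p).[x].
Proof.
rewrite /map_poly horner_poly horner_coef.
rewrite (big_morph _ ImD (erefl : complex.Im 0 = 0)).
by apply: eq_bigr => k _; rewrite -rmorphXn ImMr.
Qed.

Definition cgauss_mean p := cintegral (fun x => p.[x%:C] * (gauss x)%:C).

Lemma cintegrable_poly_gauss p :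
  cintegrable (fun x => p.[x%:C] * (gauss x)%:C).
Proof.
split.
- under [X in EFin \o X]eq_fun do rewrite ReMr Re_horner_real.
  exact: integrable_poly_gauss.
- under [X in EFin \o X]eq_fun do rewrite ImMr Im_horner_real.
  exact: integrable_poly_gauss.
Qed.

Lemma cgauss_meanE p :
  cgauss_mean p = gauss_mean (polyRe p) +i* gauss_mean (polyIm p).
Proof.
congr (_ +i* _); apply: eq_Rintegral => x _.
- by rewrite ReMr Re_horner_real.
- by rewrite ImMr Im_horner_real.
Qed.

Lemma polyReD p q : polyRe (p + q) = polyRe p + polyRe q.
Proof.
by apply/polyP => k; rewrite !(coefD, coef_map_id0)// ReD.
Qed.

Lemma polyImD p q : polyIm (p + q) = polyIm p + polyIm q.
Proof. by apply/polyP => k; rewrite !(coefD, coef_map_id0)// ImD. Qed.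

Lemma cgauss_meanD p q : cgauss_mean (p + q) = cgauss_mean p + cgauss_mean q.
Proof. by rewrite !cgauss_meanE polyReD polyImD !gauss_meanD. Qed.

Lemma cgauss_meanZ c p : cgauss_mean (c *: p) = c * cgauss_mean p.
Proof.
have -> : cgauss_mean (c *: p) =
  gauss_mean (complex.Re c *: polyRe p - complex.Im c *: polyIm p) +i*
  gauss_mean (complex.Re c *: polyIm p + complex.Im c *: polyRe p).
  rewrite cgauss_meanE; congr (gauss_mean _ +i* gauss_mean _);
    apply/polyP => k; rewrite !(coefD, coefN, coefZ, coef_map_id0)//.
  - exact: ReM.
  - exact: ImM.
rewrite gauss_meanB gauss_meanD !gauss_meanZ cgauss_meanE.
by case: c => [a b].
Qed.

Lemma cgauss_meanB p q : cgauss_mean (p - q) = cgauss_mean p - cgauss_mean q.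
Proof. by rewrite -scaleN1r cgauss_meanD cgauss_meanZ mulN1r. Qed.

Lemma cgauss_mean1 : cgauss_mean 1 = 1.
Proof.
rewrite cgauss_meanE.
have -> : polyRe 1 = 1.
  by apply/polyP => k; rewrite coef_map_id0// !coef1; case: eqP.
have -> : polyIm 1 = 0.
  by apply/polyP => k; rewrite coef_map_id0// coef1 coef0; case: eqP.
by rewrite gauss_mean1 gauss_mean0.
Qed.

Lemma cgauss_meanX p : cgauss_mean ('X * p) = cgauss_mean p^`().
Proof.
rewrite !cgauss_meanE.
have -> : polyRe ('X * p) = 'X * polyRe p.
  by apply/polyP => k; rewrite !(coefXM, coef_map_id0)//; case: eqP.
have -> : polyIm ('X * p) = 'X * polyIm p.
  by apply/polyP => k; rewrite !(coefXM, coef_map_id0)//; case: eqP.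
rewrite !gauss_meanX; congr (gauss_mean _ +i* gauss_mean _);
  apply/polyP => k; rewrite !(coef_deriv, coef_map_id0)//.
- by rewrite ReMn.
- by rewrite ImMn.
Qed.

End ComplexGaussian.

(** * Hermite polynomials *)

Section Hermite.
Variable K : comNzRingType.

(** The Rodrigues form, rather than the three-term recurrence, matches
    integration by parts directly. *)
Fixpoint hermite n : {poly K} :=
  if n is k.+1 then 'X * hermite k - (hermite k)^`() else 1.

Lemma hermiteS n : hermite n.+1 = 'X * hermite n - (hermite n)^`().
Proof. by []. Qed.

Lemma deriv_hermite0 : (hermite 0)^`() = 0.
Proof. by rewrite /= -polyC1 derivC. Qed.

(** This turns the defining recurrence into the three-term one below, and makes
    the orthogonality induction close on the same family. *)
Lemma deriv_hermiteS n : (hermite n.+1)^`() = n.+1%:R *: hermite n.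
Proof.
elim: n => [|n IHn].
  by rewrite hermiteS deriv_hermite0 mulr1 subr0 derivX scale1r.
rewrite hermiteS derivB derivM derivX mul1r IHn derivZ -scalerAr.
by rewrite -addrA -scalerBr -hermiteS -[n.+2]add1n natrD scalerDl scale1r.
Qed.

Lemma hermiteSS n :
  hermite n.+2 = 'X * hermite n.+1 - n.+1%:R *: hermite n.
Proof. by rewrite hermiteS deriv_hermiteS. Qed.

End Hermite.

(** * The Gaussian formula and orthogonality *)

Section Orthogonality.
Variable R : realType.
Local Notation H := (hermite R[i]).

(** Multiplication by x minus derivation is the adjoint of derivation for the
    Gaussian mean: E[x H_n q] = E[H_n' q + H_n q'], and H_n' q cancels. *)
Lemma cgauss_mean_hermiteSM n (q : {poly R[i]}) :
  cgauss_mean (H n.+1 * q) = cgauss_mean (H n * q^`()).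
Proof.
rewrite hermiteS mulrBl cgauss_meanB -mulrA cgauss_meanX derivM cgauss_meanD.
by rewrite addrAC subrr add0r.
Qed.

Lemma cgauss_mean_hermiteM n m :
  cgauss_mean (H n * H m) = if n == m then n`!%:R else 0.
Proof.
have cg0 : @cgauss_mean R 0 = 0 by rewrite -[0](scale0r 0) cgauss_meanZ mul0r.
elim: n m => [|n IHn] [|m].
- by rewrite mulr1 cgauss_mean1.
- by rewrite mulrC cgauss_mean_hermiteSM deriv_hermite0 mulr0 cg0.
- by rewrite cgauss_mean_hermiteSM deriv_hermite0 mulr0 cg0.
rewrite cgauss_mean_hermiteSM deriv_hermiteS -scalerAr cgauss_meanZ IHn eqSS.
by case: eqP => [<-|]; rewrite ?mulr0// factS natrM.
Qed.

(** For fixed x, the integrand of [He] is the value at z of a polynomial in z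
    with complex coefficients times the density. *)
Lemma HeE n (x : R) :
  He n x = cgauss_mean ((x%:C%:P + 'i *: 'X) ^+ n).
Proof.
rewrite /He /cgauss_mean; congr cintegral; apply/funext => z; congr (_ * _).
rewrite horner_exp hornerD hornerZ hornerC hornerX; congr (_ ^+ _).
apply/eqP; rewrite eq_complex ReD ImD ReMr ImMr /=.
by rewrite mul0r mul1r addr0 add0r !eqxx.
Qed.

(** One factor w = x + iZ of w^(n+2) is split off, and E[iZ w^(n+1)] equals
    i (n+1) i E[w^n] by integration by parts. *)
Lemma HeSS n (x : R) : He n.+2 x = x%:C * He n.+1 x - n.+1%:R * He n x.
Proof.
rewrite !HeE; set w := _ + _.
have dw : w^`() = 'i%:P by rewrite derivD derivC derivZ derivX add0r alg_polyC.
rewrite exprS {1}/w mulrDl cgauss_meanD -scalerAl cgauss_meanZ cgauss_meanX.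
rewrite mul_polyC cgauss_meanZ deriv_exp dw -scaler_nat cgauss_meanZ mul_polyC.
rewrite cgauss_meanZ; congr (_ + _).
by rewrite mulrCA (mulrA 'i) -expr2 sqr_i mulN1r mulrN.
Qed.

Lemma He_hermite n (x : R) : He n x = (H n).[x%:C].
Proof.
(* The recurrence reaches two steps back, hence two consecutive values at once. *)
suff [] : He n x = (H n).[x%:C] /\ He n.+1 x = (H n.+1).[x%:C] by [].
elim: n => [|n [IH1 IH2]]; last first.
  split=> //; rewrite HeSS hermiteSS.
  by rewrite hornerD hornerN hornerM hornerX hornerZ IH1 IH2.
split.
  by rewrite HeE expr0 cgauss_mean1 hornerC.
rewrite HeE expr1 cgauss_meanD cgauss_meanZ -['X]mulr1 cgauss_meanX.
rewrite -polyC1 derivC -[0](scale0r 1) cgauss_meanZ mul0r mulr0 addr0.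
rewrite -[_%:P]mulr1 mul_polyC cgauss_meanZ cgauss_mean1 mulr1.
by rewrite hermiteS deriv_hermite0 subr0 mulr1 hornerX.
Qed.

End Orthogonality.

Theorem proposition2p6 (R : realType) (n m : nat) :
  cintegrable (fun x : R => He n x * He m x * (gauss x)%:C) /\
  cintegral (fun x : R => He n x * He m x * (gauss x)%:C) =
    (if n == m then (n`!)%:R else 0).
Proof.
have -> : (fun x : R => He n x * He m x * (gauss x)%:C) =
    (fun x : R => (hermite R[i] n * hermite R[i] m).[x%:C] * (gauss x)%:C).
  by apply/funext => x; rewrite !He_hermite hornerM.
split; first exact: cintegrable_poly_gauss.
exact: cgauss_mean_hermiteM.
Qed.
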